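(* A graph $G$ is paw-induced-saturated if and only if $G$ has at most one trivial component (isolated vertex) and every nontrivial component of $G$ is a complete multipartite graph with at least three parts, at most one of which consists of a single vertex, and all other parts of which have at least three vertices.
   Context: All graphs are finite and simple. The paw is the graph obtained from $K_{1,3}$ by adding one edge (a triangle with a pendant vertex). For a graph $H$, a graph $G$ is $H$-induced-saturated if $G$ contains no induced subgraph isomorphic to $H$, but for every pair of distinct vertices $u,v$ of $G$, the graph obtained from $G$ by adding the edge $uv$ (if $uv\notin E(G)$) or deleting it (if $uv\in E(G)$) contains an induced subgraph isomorphic to $H$. *)

(* Defs.v *)
From mathcomp Require Import all_boot.

Set Implicit Arguments.
Unset Strict Implicit.
Unset Printing Implicit Defensive.

Record sgraph := SGraph {
  vertex :> finType;
  adj : rel vertex;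
  adj_sym : symmetric adj;
  adj_irrefl : irreflexive adj }.

Section Graphs.
Variable G : sgraph.
Implicit Types (u v : G) (A : {set G}).

Section Induced.
Variable A : {set G}.

Definition induced_adj : rel {x : G | x \in A} :=
  fun x y => adj (val x) (val y).

Fact induced_adj_sym : symmetric induced_adj.
Proof. by move=> x y; exact: adj_sym. Qed.

Fact induced_adj_irrefl : irreflexive induced_adj.
Proof. by move=> x; exact: adj_irrefl. Qed.

Definition induced : sgraph := SGraph induced_adj_sym induced_adj_irrefl.

End Induced.

Section EdgeOperations.
Variables u v : G.

(* The guard [x != y] keeps the relation irreflexive when [u = v], in which
   case [add_edge] does nothing. *)
Definition add_edge_adj : rel G :=
  fun x y => adj x y || (x != y) && ([set x; y] == [set u; v]).

Fact add_edge_adj_sym : symmetric add_edge_adj.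
Proof. by move=> x y; rewrite /add_edge_adj adj_sym eq_sym setUC. Qed.

Fact add_edge_adj_irrefl : irreflexive add_edge_adj.
Proof. by move=> x; rewrite /add_edge_adj adj_irrefl eqxx. Qed.

Definition add_edge : sgraph := SGraph add_edge_adj_sym add_edge_adj_irrefl.

Definition del_edge_adj : rel G :=
  fun x y => adj x y && ([set x; y] != [set u; v]).

Fact del_edge_adj_sym : symmetric del_edge_adj.
Proof. by move=> x y; rewrite /del_edge_adj adj_sym setUC. Qed.

Fact del_edge_adj_irrefl : irreflexive del_edge_adj.
Proof. by move=> x; rewrite /del_edge_adj adj_irrefl. Qed.

Definition del_edge : sgraph := SGraph del_edge_adj_sym del_edge_adj_irrefl.

Definition flip_edge : sgraph := if adj u v then del_edge else add_edge.

End EdgeOperations.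

Definition components : {set {set G}} :=
  [set [set y | connect (@adj G) x y] | x : G].

Definition trivial_component (C : {set G}) : bool :=
  (C \in components) && (#|C| == 1).

Definition nontrivial_component (C : {set G}) : bool :=
  (C \in components) && (#|C| != 1).

(* [partition] forces the parts to be nonempty, so [#|P|] is the number of
   parts of the complete multipartite graph. *)
Definition complete_multipartite (P : {set {set G}}) : Prop :=
  partition P [set: G] /\
  forall A B, A \in P -> B \in P ->
    forall x y, x \in A -> y \in B -> adj x y = (A != B).

End Graphs.

Definition isomorphic (G H : sgraph) : Prop :=
  exists2 f : G -> H, bijective f & forall x y, adj (f x) (f y) = adj x y.

Definition has_induced (H G : sgraph) : Prop :=
  exists A : {set G}, isomorphic (induced A) H.

Definition induced_saturated (H G : sgraph) : Prop :=
  ~ has_induced H G /\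
  forall u v : G, u != v -> has_induced H (flip_edge u v).

Section CompleteBipartite.
Variables m n : nat.

Definition complete_bipartite_adj : rel ('I_m + 'I_n) :=
  fun x y => match x, y with
             | inl _, inr _ | inr _, inl _ => true
             | _, _ => false
             end.

Fact complete_bipartite_adj_sym : symmetric complete_bipartite_adj.
Proof. by case=> i; case=> j. Qed.

Fact complete_bipartite_adj_irrefl : irreflexive complete_bipartite_adj.
Proof. by case. Qed.

Definition complete_bipartite : sgraph :=
  SGraph complete_bipartite_adj_sym complete_bipartite_adj_irrefl.

End CompleteBipartite.

Definition paw : sgraph :=
  @add_edge (complete_bipartite 1 3) (inr ord0) (inr ord_max).

(* Main.v *)
(** Deleting an edge [uv] from a paw-free graph can only create a paw in which
    [u] and [v] are the pendant vertex and a vertex of degree two, so in a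
    paw-induced-saturated graph every edge lies in a triangle.  In a paw-free
    graph a vertex with a neighbour in a triangle has at least two neighbours in
    it; hence the property "adjacent to at least two vertices of a given
    triangle" propagates along edges, and every vertex of the component of an
    edge [xy] is adjacent to [x] or to [y].  So non-adjacency is an equivalence
    relation on every nontrivial component.  The sizes of its classes are
    governed by one condition, which also bounds the number of isolated
    vertices: a paw created by flipping [uv] contains a third vertex, connected
    to [u] or [v], that is not adjacent to both. *)
Require Import Defs.
From mathcomp Require Import all_boot.

Set Implicit Arguments.
Unset Strict Implicit.
Unset Printing Implicit Defensive.

(** * Induced paws as adjacency patterns on four vertices *)

Lemma has_inducedP (H G : sgraph) :
  has_induced H G <->
  exists2 f : H -> G, injective f & forall x y, adj (f x) (f y) = adj x y.
Proof.
split=> [[A [f [g fK gK] fP]]|[f f_inj fP]].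
  exists (fun x => val (g x)) => [x y /val_inj|x y]; first exact: (can_inj gK).
  by rewrite -[x in RHS]gK -[y in RHS]gK fP.
pose A := [set f x | x : H]; exists A.
have fA x : f x \in A by exact: imset_f.
pose g x : induced A := exist _ (f x) (fA x).
have g_inj : injective g by move=> x y [] /f_inj.
have [|h gK hK] := @inj_card_bij H (induced A) g g_inj.
  by rewrite card_sig -(card_imset predT f_inj); apply/eq_leq/eq_card.
exists h; first by exists g.
by move=> x y; rewrite -fP -[x in RHS]hK -[y in RHS]hK.
Qed.

(** The triangle is [a b c] and [d] is pendant at [c]. Distinctness is not demanded: in a graph it
    follows from the pattern. Taking a relation instead of a graph lets the pattern apply to
    [flip_adj]. *)
Definition paw_pattern (T : Type) (e : rel T) (a b c d : T) :=
  [&& e a b, e a c, e b c, e c d, ~~ e a d & ~~ e b d].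

Lemma has_pawP (G : sgraph) :
  has_induced paw G <-> exists a b c d : G, paw_pattern (@adj G) a b c d.
Proof.
(* The added edge joins leaves 0 and 2 of the star, so the centre has degree three and leaf 1 is the
   pendant vertex. *)
have paw_adjE (x y : 'I_1 + 'I_3) : @adj paw x y = match x, y with
    | inl _, inr _ | inr _, inl _ => true
    | inr i, inr j => (i != j) && (i != 1 :> nat) && (j != 1 :> nat)
    | inl _, inl _ => false end.
  rewrite /= /add_edge_adj /= eqEsubset !subUset !sub1set !inE.
  move: x y => [x|x] [y|y] //=; first by rewrite !ord1 eqxx.
  by case: x => [[|[|[|[]]]] ?] //; case: y => [[|[|[|[]]]] ?].
split=> [/has_inducedP[f _ fP]|[a [b [c [d]]]]].
  exists (f (inr ord0)), (f (inr ord_max)), (f (inl ord0)).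
  by exists (f (inr (lift ord0 ord0))); rewrite /paw_pattern !fP !paw_adjE.
case/and5P=> ab ac bc cd /andP[/negbTE ad /negbTE bd]; apply/has_inducedP.
pose f (x : 'I_1 + 'I_3) :=
  match x with inl _ => c | inr i => nth a [:: a; d; b] i end.
have fP (x y : 'I_1 + 'I_3) : adj (f x) (f y) = @adj paw x y.
  rewrite paw_adjE; case: x => [x|[[|[|[|[]]]] ?]] //;
    by case: y => [y|[[|[|[|[]]]] ?]] //=;
      rewrite ?adj_irrefl // 1?adj_sym ?ab ?ac ?bc ?cd ?ad ?bd //
        1?adj_sym ?ab ?ac ?bc ?cd ?ad ?bd.
exists f => // x y fxy.
(* No two vertices of the paw have the same neighbourhood, so a map that preserves and reflects
   adjacency is injective. *)
have twin z : @adj paw x z = @adj paw y z by rewrite -!fP fxy.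
move: (twin (inl ord0)) (twin (inr ord0)) (twin (inr ord_max))
  (twin (inr (lift ord0 ord0))); rewrite !paw_adjE.
case: x {fxy twin} => [x|[[|[|[|[]]]] ?]] //;
  case: y => [y|[[|[|[|[]]]] ?]] //= *; rewrite ?(ord1 x) ?(ord1 y) //;
  by congr inr; apply: val_inj.
Qed.

(** One formula for both branches of [flip_edge]. For [u = v] it would create a loop, hence the
    hypothesis [u != v] below. *)
Definition flip_adj (G : sgraph) (u v : G) : rel G :=
  fun x y => adj x y (+) ((x == u) && (y == v) || (x == v) && (y == u)).

Lemma flip_adjC (G : sgraph) (u v : G) : flip_adj u v =2 flip_adj v u.
Proof. by move=> x y; rewrite /flip_adj orbC. Qed.

Lemma flip_pawP (G : sgraph) (u v : G) : u != v ->
  has_induced paw (flip_edge u v) <->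
  exists a b c d : G, paw_pattern (flip_adj u v) a b c d.
Proof.
move=> uv.
have set2_eq x y : ([set x; y] == [set u; v])
    = (x == u) && (y == v) || (x == v) && (y == u).
  apply/eqP/idP => [/setP E|].
    move: (E u) (E v) (E x) (E y) uv; rewrite !inE !eqxx !(eq_sym u) !(eq_sym v) ?orbT.
    by do 2 case: eqVneq => ? //=; subst; do ?case: eqVneq => ? //=.
  by case/orP=> /andP[/eqP-> /eqP->] //; rewrite setUC.
have fE (e : rel G) : e =2 flip_adj u v ->
    (exists a b c d : G, paw_pattern e a b c d) <->
    (exists a b c d : G, paw_pattern (flip_adj u v) a b c d).
  by move=> E; split=> -[a [b [c [d H]]]]; exists a, b, c, d; move: H;
    rewrite /paw_pattern !E.
rewrite /flip_edge; case: ifP => adjuv; apply: (iff_trans (has_pawP _)); apply: fE => x y /=.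
  rewrite /del_edge_adj set2_eq /flip_adj; case: orP; last by rewrite andbT addbF.
  by case=> /andP[/eqP-> /eqP->]; rewrite ?[adj v u]adj_sym adjuv.
rewrite /add_edge_adj set2_eq /flip_adj.
case: (boolP (_ && _ || _ && _)); last by rewrite andbF orbF addbF.
by case/orP=> /andP[/eqP-> /eqP->]; rewrite ?[adj v u]adj_sym adjuv ?uv // eq_sym uv.
Qed.

(** * Complete multipartite graphs through non-adjacency *)

(** In a complete multipartite graph this says that [w] is a further vertex of the part of [u] or of
    the part of [v]. *)
Definition separates (G : sgraph) (u v w : G) :=
  [&& w != u, w != v & ~~ (adj w u && adj w v)].

Lemma separatesC (G : sgraph) (u v w : G) : separates u v w = separates v u w.
Proof. by rewrite /separates andbCA [adj w u && _]andbC. Qed.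

(* The third condition forbids two singleton parts when [x] and [y] are
   adjacent, and a part of size two when they are not. *)
Definition multipartite_saturated (G : sgraph) (C : {set G}) :=
  [/\ {in C & &, forall x y z, adj x y -> adj x z || adj y z},
      exists a b c, [/\ a \in C, b \in C & c \in C] /\
        [&& adj a b, adj a c & adj b c]
    & {in C &, forall x y, x != y -> exists2 w, w \in C & separates x y w}].

(** The parts are the classes of non-adjacency, whose transitivity is the first condition in
    contrapositive form; a triangle is a choice of vertices in three different parts. *)
Lemma multipartiteP (G : sgraph) :
  (exists P : {set {set G}},
       [/\ complete_multipartite P,
           3 <= #|P|,
           #|[set A in P | #|A| == 1]| <= 1
         & forall A, A \in P -> #|A| != 1 -> 3 <= #|A| ]) <->
  multipartite_saturated [set: G].
Proof.
split.
  case=> P [[Ppart Padj] P3 P1 Pbig].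
  have part x : exists2 A, A \in P & x \in A.
    have: x \in cover P by rewrite (cover_partition Ppart) inE.
    by case/bigcupP=> A; exists A.
  split.
  - move=> x y z _ _ _.
    have [[[A AP xA] [B BP yB]] [C CP zC]] := (part x, part y, part z).
    rewrite (Padj A B) // (Padj A C) // (Padj B C) //.
    by case: (eqVneq A C) => [<-|//] /=; rewrite eq_sym.
  - have [A [B [C [[AP BP CP] [AB BC CA]]]]] := card_gt2P P3.
    have ne D : D \in P -> exists x, x \in D.
      by move=> DP; apply/set0Pn; exact: (partition_neq0 Ppart DP).
    have [[[a aA] [b bB]] [c cC]] := (ne _ AP, ne _ BP, ne _ CP).
    exists a, b, c; split; first by rewrite !inE.
    by rewrite (Padj A B) // (Padj A C) // (Padj B C) // AB BC eq_sym CA.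
  move=> x y _ _ xy.
  have [[A AP xA] [B BP yB]] := (part x, part y).
  have big (D : {set G}) z : z \in D -> #|D| != 1 -> exists2 w, w \in D & w != z.
    move=> zD D1; have: 1 < #|D| by rewrite ltn_neqAle eq_sym D1; apply/card_gt0P; exists z.
    rewrite (cardsD1 z) zD => /card_gt0P[w]; rewrite !inE => /andP[]; by exists w.
  case: (eqVneq A B) => [eAB|nAB].
    (* A part with two distinct vertices has a third one, which is adjacent to neither. *)
    subst B; have A3 : 3 <= #|A|.
      apply: Pbig => //; apply/eqP => /eqP/cards1P[t At].
      by move: xA yB xy; rewrite At !inE => /eqP-> /eqP->; rewrite eqxx.
    have : 0 < #|A :\ x :\ y|.
      by move: A3; rewrite (cardsD1 x) xA (cardsD1 y) !inE eq_sym xy yB.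
    case/card_gt0P=> w; rewrite !inE => /and3P[wy wx wA].
    by exists w => //; rewrite /separates wx wy (Padj A A) // eqxx.
  (* At most one part is a singleton, so one of the two parts has a second vertex, not adjacent to
     the first. *)
  have : (#|A| != 1) || (#|B| != 1).
    rewrite -negb_and; apply/negP=> /andP[A1 B1]; case/eqP: nAB.
    by apply: (card_le1_eqP P1); rewrite inE ?AP ?BP.
  have disj w : w \in A -> w \in B -> False.
    move=> wA wB; move: (Padj _ _ AP BP _ _ wA wB).
    by rewrite adj_irrefl nAB.
  case/orP=> [/(big _ _ xA)|/(big _ _ yB)] [w wD wn]; exists w => //.
    rewrite /separates wn (Padj A A) // eqxx andbT.
    by apply/eqP=> ?; subst w; exact: disj yB.
  rewrite /separates wn (Padj _ _ BP BP w y) // eqxx andbF andbT.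
  by apply/eqP=> ?; subst w; exact: disj wD.
case=> trans [a [b [c [_ /and3P[ab ac bc]]]]] sep.
pose e x y := ~~ @adj G x y.
have e_equiv : {in [set: G] & &, equivalence_rel e}.
  move=> x y z _ _ _; rewrite /e adj_irrefl; split=> // xy.
  have [xt yt zt] : [/\ x \in [set: G], y \in [set: G] & z \in [set: G]] by rewrite !inE.
  congr negb; apply/idP/idP => xz.
    by have := trans _ _ _ xt zt yt xz; rewrite (negbTE xy) adj_sym.
  by have := trans _ _ _ yt zt xt xz; rewrite adj_sym (negbTE xy) adj_sym.
pose P := equivalence_partition e [set: G].
have Ppart : partition P [set: G] := equivalence_partitionP e_equiv.
have Ptriv : trivIset P := partition_trivIset Ppart.
have Pcov x : x \in cover P by rewrite (cover_partition Ppart) inE.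
have Padj A B : A \in P -> B \in P ->
    forall x y, x \in A -> y \in B -> adj x y = (A != B).
  move=> AP BP x y xA yB.
  rewrite -(def_pblock Ptriv AP xA) -(def_pblock Ptriv BP yB).
  by rewrite eq_pblock // (pblock_equivalence_partition e_equiv) ?inE // negbK.
have inP x : pblock P x \in P by exact: pblock_mem.
have inb x : x \in pblock P x by rewrite mem_pblock.
exists P; split=> //.
- apply/card_gt2P; exists (pblock P a), (pblock P b), (pblock P c).
  by split=> //; split; rewrite -(Padj _ _ (inP _) (inP _) _ _ (inb _) (inb _))
    // adj_sym.
- apply/card_le1_eqP => A B; rewrite !inE => /andP[AP /cards1P[x Ax]].
  case/andP=> BP /cards1P[y By]; subst A B; apply/eqP/contraT => nxy.
  (* A vertex outside two singleton parts is adjacent to both of their elements, so nothing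
     separates them. *)
  have /(sep _ _ (in_setT x) (in_setT y)) [w _ /and3P[wx wy]] : x != y.
    by apply: contra nxy => /eqP->.
  have single z : [set z] \in P -> w != z -> adj w z.
    move=> zP wz; rewrite (Padj _ _ (inP w) zP) ?inE //.
    by apply: contra wz => /eqP E; have := inb w; rewrite E inE.
  by rewrite !single.
move=> A AP A1; have /set0Pn[x xA] := partition_neq0 Ppart AP.
have: 0 < #|A :\ x|.
  by move: A1; rewrite (cardsD1 x) xA; case: #|_|.
case/card_gt0P=> y; rewrite !inE => /andP[yx yA].
have /(sep _ _ (in_setT y) (in_setT x)) [w _ /and3P[wy wx wadj]] := yx.
(* The separating vertex misses [x] or [y], hence lies in their common part and is its third
   element. *)
have wA : w \in A.
  have E z : z \in A -> ~~ adj w z -> w \in A.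
    move=> zA; rewrite (Padj _ _ (inP w) AP) // negbK => /eqP <-; exact: inb.
  by move: wadj; rewrite negb_and => /orP[]; apply: E.
by apply/card_gt2P; exists x, y, w; split; split; rewrite // eq_sym.
Qed.

Lemma induced_multipartiteP (G : sgraph) (C : {set G}) :
  multipartite_saturated [set: induced C] <-> multipartite_saturated C.
Proof.
split=> -[trans [a [b [c [abcC abc]]]] sep].
  split.
  - move=> x y z xC yC zC.
    exact: (trans (Sub x xC) (Sub y yC) (Sub z zC)).
  - by exists (val a), (val b), (val c); split=> //; split; exact: valP.
  move=> x y xC yC xy.
  have [||//|w _ wsep] := sep (Sub x xC) (Sub y yC); rewrite ?inE //.
  by exists (val w); first exact: valP.
split.
- by move=> x y z _ _ _; apply: trans; exact: valP.
- case: abcC => aC bC cC.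
  by exists (Sub a aC), (Sub b bC), (Sub c cC); split=> //; rewrite !inE.
move=> x y _ _ xy; have [||//|w wC wsep] := sep (val x) (val y); try exact: valP.
by exists (Sub w wC); rewrite ?inE.
Qed.

(** * Paws created by a flip in a paw-free graph *)

Section PawFree.
Variable G : sgraph.
Hypothesis paw_free : ~ has_induced paw G.

Lemma paw_freeP (a b c d : G) :
  adj a b -> adj a c -> adj b c -> adj c d -> adj a d || adj b d.
Proof.
move=> ab ac bc cd; apply/negPn; rewrite negb_or; apply/negP=> nadj.
by apply/paw_free/has_pawP; exists a, b, c, d; rewrite /paw_pattern ab ac bc cd.
Qed.

Lemma triangle_dominates (a b c z : G) :
  adj a b -> adj a c -> adj b c -> connect (@adj G) a z -> adj a z || adj b z.
Proof.
move=> ab ac bc.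
pose two x := [|| adj a x && adj b x, adj a x && adj c x | adj b x && adj c x].
have [ba ca cb] : [/\ adj b a, adj c a & adj c b].
  by rewrite [adj b a]adj_sym [adj c a]adj_sym [adj c b]adj_sym.
(* If [x] sees [a] and [b], paw-freeness at the triangle [a b x] gives [y] one neighbour among them,
   and paw-freeness at [a b c] then gives a second one. The other cases are alike. *)
have two_step x y : two x -> adj x y -> two y.
  rewrite /two => /or3P[] /andP[? ?] xy.
  - have /orP[H|H] : adj a y || adj b y by exact: (@paw_freeP a b x).
      by have := @paw_freeP b c a y bc ba ca H; rewrite H => /orP[]->; rewrite ?orbT.
    by have := @paw_freeP a c b y ac ab cb H; rewrite H => /orP[]->; rewrite ?orbT.
  - have /orP[H|H] : adj a y || adj c y by exact: (@paw_freeP a c x).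
      by have := @paw_freeP b c a y bc ba ca H; rewrite H => /orP[]->; rewrite ?orbT.
    by have := @paw_freeP a b c y ab ac bc H; rewrite H => /orP[]->; rewrite ?orbT.
  - have /orP[H|H] : adj b y || adj c y by exact: (@paw_freeP b c x).
      by have := @paw_freeP a c b y ac ab cb H; rewrite H => /orP[]->; rewrite ?orbT.
    by have := @paw_freeP a b c y ab ac bc H; rewrite H => /orP[]->; rewrite ?orbT.
case/connectP=> p path_p ->.
have: two a by rewrite /two ba ca !orbT.
suff two_last : forall x, path (@adj G) x p -> two x -> two (last x p).
  (* Any two of the three triangle vertices include [a] or [b]. *)
  by move=> /(two_last _ path_p) /or3P[] /andP[-> _]; rewrite ?orbT.
elim: p {path_p} => //= y p IHp x /andP[xy yp] /two_step/(_ xy).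
exact: IHp.
Qed.

(** The deleted edge must be one of the two non-edges of the new paw, as otherwise the paw was
    already in [G]. In the conclusion [p] is the pendant vertex, [q] and [x] have degree two, and
    [y] has degree three. *)
Lemma del_paw (u v : G) (e := flip_adj u v) (a b c d : G) : adj u v ->
  paw_pattern e a b c d ->
  exists p q x y, [/\ (p, q) = (u, v) \/ (p, q) = (v, u),
    [&& adj q x, adj q y, adj x y & adj p y], x != p & ~~ adj p x].
Proof.
move=> uv.
pose pair x y := (x == u) && (y == v) || (x == v) && (y == u).
have pair_adj x y : pair x y -> adj x y.
  by case/orP=> /andP[/eqP-> /eqP->] //; rewrite adj_sym.
have eE x y : e x y = adj x y && ~~ pair x y.
  rewrite /e /flip_adj -/(pair x y).
  by case: (pair x y) (pair_adj x y) => [->|_]; rewrite ?addbF ?andbT.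
have pairC x y : pair x y = pair y x by rewrite /pair orbC ![(y == _) && _]andbC.
have pairP x y : pair x y -> (y, x) = (u, v) \/ (y, x) = (v, u).
  by case/orP=> /andP[/eqP-> /eqP->]; [right|left].
rewrite /paw_pattern !eE !negb_and !negbK.
case/and5P=> /andP[ab nab'] /andP[ac _] /andP[bc _] /andP[cd _].
have nab : a != b by apply: contraTneq ab => ->; rewrite adj_irrefl.
have pair_inj x y z : pair x z -> pair y z -> x = y.
  have nuv : u != v by apply: contraTneq uv => ->; rewrite adj_irrefl.
  by case/orP=> /andP[/eqP-> /eqP->]; case/orP=> /andP[/eqP->] //;
    rewrite ?[v == u]eq_sym (negbTE nuv).
rewrite [adj a d]adj_sym [adj b d]adj_sym.
case: (boolP (pair a d)) => [ad|nad]; case: (boolP (pair b d)) => [bd|nbd].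
- by case/eqP: nab; exact: pair_inj bd.
- rewrite orbT orbF /= => db.
  exists d, a, b, c; split=> //; [exact: pairP|by rewrite ab ac bc adj_sym|].
    by apply: contraNneq nab' => ->.
- rewrite orbT orbF andbT => da.
  exists d, b, a, c; split=> //; [exact: pairP|by rewrite adj_sym ab bc ac adj_sym|].
    by apply: contraNneq nab' => ->; rewrite pairC.
rewrite !orbF => /andP[/negbTE da /negbTE db].
by have := paw_freeP ab ac bc cd; rewrite ![adj _ d]adj_sym da db.
Qed.

(** The degree-three vertex of the new paw is adjacent to both ends of the deleted edge. *)
Lemma flip_edge_triangle (u v : G) : adj u v ->
  has_induced paw (flip_edge u v) -> exists c, adj u c && adj v c.
Proof.
move=> uv; have nuv : u != v by apply: contraTneq uv => ->; rewrite adj_irrefl.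
case/(flip_pawP nuv) => a [b [c [d /(del_paw uv)]]].
by case=> p [q [x [y [[] [-> ->] /and4P[_ ? _ ?] _ _]]]]; exists y; apply/andP.
Qed.

(** The added edge is one of the four edges of the paw. If it lies in the triangle, the pendant
    vertex [d] separates its ends; if it is [cd], then [a] does. *)
Lemma add_paw_separates (u v : G) (e := flip_adj u v) (a b c d : G) :
  u != v -> ~~ adj u v -> paw_pattern e a b c d ->
  exists2 w, connect (@adj G) u w || connect (@adj G) v w & separates u v w.
Proof.
move=> nuv uv.
pose pair x y := (x == u) && (y == v) || (x == v) && (y == u).
have pairP x y : pair x y -> (x, y) = (u, v) \/ (x, y) = (v, u).
  by case/orP=> /andP[/eqP-> /eqP->]; [left|right].
have pair_adj x y : pair x y -> ~~ adj x y.
  by case/pairP=> -[-> ->] //; rewrite adj_sym.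
have eE x y : e x y = adj x y || pair x y.
  rewrite /e /flip_adj -/(pair x y).
  by case: (pair x y) (pair_adj x y) => [/(_ isT)/negbTE->|_]; rewrite ?addbF ?orbF.
have pairC x y : pair x y = pair y x by rewrite /pair orbC ![(y == _) && _]andbC.
have eC x y : e x y = e y x by rewrite !eE adj_sym pairC.
have ee x : e x x = false.
  rewrite eE adj_irrefl; apply/negP=> /pairP[] [-> E]; move: nuv;
  by rewrite E eqxx.
case/and5P=> ab ac bc cd /andP[ad bd].
have neq x y z : e x y -> ~~ e x z -> y != z.
  by move=> xy; apply: contraNneq => <-.
have [dna dnb dnc] : [/\ d != a, d != b & d != c].
  split; rewrite eq_sym.
  - by apply: (neq b) => //; rewrite eC.
  - exact: (neq a).
  exact: (neq a).
have nc : c != a /\ c != b.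
  by split; [apply: (neq a); rewrite ?ee|apply: (neq b); rewrite ?ee].
have sepW x y w : pair x y -> connect (@adj G) x w || connect (@adj G) y w ->
    w != x -> w != y -> ~~ (adj w x && adj w y) ->
    exists2 w, connect (@adj G) u w || connect (@adj G) v w & separates u v w.
  case/pairP=> -[-> ->] cw wx wy nw; exists w => //; rewrite 1?orbC //.
    by rewrite /separates wx wy.
  by rewrite separatesC /separates wx wy.
have pair_mem x y z t : pair x y -> pair z t -> (z == x) || (z == y).
  by case/pairP=> -[-> ->]; case/pairP=> -[-> _]; rewrite eqxx ?orbT.
have [nca ncb] := nc.
have nadj x : e x d = false -> adj d x = false.
  by rewrite eE adj_sym => /negbT; rewrite negb_or => /andP[/negbTE].
have [da db] : adj d a = false /\ adj d b = false.
  by split; apply: nadj; apply: negbTE.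
have reach x y z : adj x y -> adj y z -> connect (@adj G) x z.
  by move=> xy /(connect1)/(connect_trans (connect1 xy)).
(* An edge with an end outside the added pair was present before the flip. *)
have edge x y z t : pair z t -> x != z -> x != t -> e x y -> adj x y.
  move=> zt xz xt; rewrite eE => /orP[//|/(pair_mem _ _ _ _ zt)].
  by rewrite (negbTE xz) (negbTE xt).
case: (boolP (pair a b)) => [pab|nab].
  apply: (sepW a b d) => //; last by rewrite da.
  have ca : adj c a by apply: edge pab _ _ _; rewrite // eC.
  by rewrite (@reach a c d) //; [rewrite adj_sym|exact: edge pab _ _ _].
case: (boolP (pair a c)) => [pac|nac].
  apply: (sepW a c d) => //; last by rewrite da.
  have dc : adj d c by apply: edge pac _ _ _; rewrite // eC.
  by rewrite [X in _ || X]connect1 ?orbT // adj_sym.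
case: (boolP (pair b c)) => [pbc|nbc].
  apply: (sepW b c d) => //; last by rewrite db.
  have dc : adj d c by apply: edge pbc _ _ _; rewrite // eC.
  by rewrite [X in _ || X]connect1 ?orbT // adj_sym.
have [adj_ab adj_ac adj_bc] : [/\ adj a b, adj a c & adj b c].
  by move: ab ac bc; rewrite !eE (negbTE nab) (negbTE nac) (negbTE nbc) !orbF.
case: (boolP (pair c d)) => [pcd|ncd].
  apply: (sepW c d a) => //; rewrite 1?eq_sym //.
    by rewrite connect1 // adj_sym.
  by rewrite [adj a d]adj_sym da andbF.
have adj_cd : adj c d by move: cd; rewrite eE (negbTE ncd) orbF.
have := paw_freeP adj_ab adj_ac adj_bc adj_cd.
by rewrite ![adj _ d]adj_sym da db.
Qed.

(** For a deleted edge, the separating vertex is the other vertex of degree two: it is adjacent to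
    one end and not to the pendant one. *)
Lemma flip_paw_separates (u v : G) : u != v ->
  has_induced paw (flip_edge u v) ->
  exists2 w, connect (@adj G) u w || connect (@adj G) v w & separates u v w.
Proof.
move=> nuv /(flip_pawP nuv) [a [b [c [d H]]]].
case: (boolP (adj u v)) => [uv|uv]; last exact: add_paw_separates H.
case: (del_paw uv H) => p [q [x [y [pq /and4P[qx _ _ _] xp px]]]].
have xq : x != q by apply: contraTneq qx => ->; rewrite adj_irrefl.
exists x; first by case: pq => -[<- <-]; rewrite (connect1 qx) ?orbT.
have sep : separates p q x by rewrite /separates xp xq [adj x p]adj_sym negb_and px.
by case: pq => -[<- <-] //; rewrite separatesC.
Qed.

End PawFree.

(** Each vertex of [C] misses at most one of [a], [b], [c], so [x] and [y] have a common neighbour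
    among these three. *)
Lemma triangle_multipartite (G : sgraph) (C : {set G}) :
  multipartite_saturated C -> {in C &, forall x y, adj x y ->
    exists2 z, z \in C & adj x z && adj y z}.
Proof.
case=> trans [a [b [c [[aC bC cC] /and3P[ab ac bc]]]]] _ x y xC yC xy.
have two z : z \in C -> [|| adj z a && adj z b, adj z a && adj z c | adj z b && adj z c].
  move=> zC; move: (trans _ _ _ aC bC zC ab) (trans _ _ _ aC cC zC ac)
    (trans _ _ _ bC cC zC bc); rewrite ![adj _ z]adj_sym.
  by do 3 case: (adj z _).
have /or3P[] : [|| adj x a && adj y a, adj x b && adj y b | adj x c && adj y c].
- move: (two x xC) (two y yC); do 3 case: (adj x _) => //=;
  by do 3 case: (adj y _).
- by exists a.
- by exists b.
by exists c.
Qed.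

(** * Passing between a graph and its components *)

Section Components.
Variable G : sgraph.

Definition component (x : G) : {set G} := [set y | connect (@adj G) x y].

Lemma mem_component (x : G) : x \in component x.
Proof. by rewrite inE connect0. Qed.

Lemma connect_adj_sym (x y : G) : connect (@adj G) x y = connect (@adj G) y x.
Proof. by apply: sym_connect_sym => ? ?; rewrite adj_sym. Qed.

Lemma nontrivial_componentP (C : {set G}) :
  nontrivial_component C <-> exists x y : G, C = component x /\ adj x y.
Proof.
split=> [/andP[/imsetP[x _ ->] C1]|[x [y [-> xy]]]].
  have: 0 < #|component x :\ x|.
    by move: C1; rewrite (cardsD1 x) mem_component; case: #|_|.
  case/card_gt0P=> z; rewrite !inE => /andP[zx /connectP[[|y p] /=]].
    by move=> _ ezx; rewrite ezx eqxx in zx.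
  by case/andP=> xy _ _; exists x, y.
rewrite /nontrivial_component imset_f //=; apply/eqP=> /eqP/cards1P[z xz].
have /set1P xE : x \in [set z] by rewrite -xz mem_component.
have /set1P yE : y \in [set z] by rewrite -xz inE connect1.
by move: xy; rewrite xE yE adj_irrefl.
Qed.

Lemma trivial_componentP (C : {set G}) :
  reflect (exists2 x, C = [set x] & component x = [set x]) (trivial_component C).
Proof.
apply: (iffP andP) => [[/imsetP[x _ ->] /cards1P[y xy]]|[x -> xx]].
  have /set1P xE : x \in [set y] by rewrite -xy mem_component.
  by exists x; rewrite xE -?xy -?xE.
by rewrite cards1 -xx imset_f.
Qed.

Lemma saturated_component (x y : G) :
  induced_saturated paw G -> adj x y -> multipartite_saturated (component x).
Proof.
move=> [free sat] xy.
have triangle (u v : G) : adj u v -> exists c, adj u c && adj v c.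
  move=> uv; apply: flip_edge_triangle => //; apply: sat.
  by apply: contraTneq uv => ->; rewrite adj_irrefl.
split.
- move=> u v w; rewrite !inE => xu _ xw uv.
  have [c /andP[uc vc]] := triangle u v uv.
  apply: (triangle_dominates free uv uc vc).
  by apply: connect_trans xw; rewrite connect_adj_sym.
- have [z /andP[xz yz]] := triangle x y xy.
  by exists x, y, z; rewrite !inE connect0 !connect1 // xy xz yz.
move=> u v; rewrite !inE => xu xv uv.
have [w uvw sep] := flip_paw_separates free uv (sat _ _ uv); exists w => //.
by rewrite inE; case/orP: uvw; apply: connect_trans.
Qed.

Hypothesis components_saturated :
  forall x y : G, adj x y -> multipartite_saturated (component x).

(** The pendant vertex of a paw is adjacent to neither end of the opposite triangle edge, against
    transitivity of non-adjacency. *)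
Lemma multipartite_paw_free : ~ has_induced paw G.
Proof.
case/has_pawP=> a [b [c [d]]].
case/and5P=> ab ac _ cd /andP[/negbTE ad /negbTE bd].
have [trans _ _] := components_saturated ab.
have := trans a b d; rewrite !inE connect0 connect1 // ad bd.
by rewrite (connect_trans (connect1 ac) (connect1 cd)) => /(_ isT isT isT ab).
Qed.

Lemma flip_adj_off (u v x z : G) : z != u -> z != v ->
  (flip_adj u v x z = adj x z) * (flip_adj u v z x = adj x z).
Proof.
move=> /negbTE zu /negbTE zv.
by rewrite /flip_adj zu zv !andbF !addbF [adj z x]adj_sym.
Qed.

Lemma flip_adj_diag (u v : G) : u != v ->
  (flip_adj u v u v = ~~ adj u v) * (flip_adj u v v u = ~~ adj u v).
Proof.
by move=> uv; rewrite /flip_adj !eqxx orbT !addbT [adj v u]adj_sym.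
Qed.

Lemma adj_neq (x y : G) : adj x y -> x != y.
Proof. by apply: contraTneq => ->; rewrite adj_irrefl. Qed.

(** Here [w] is in the part of [u] and [z] in a third part: the triangle [v w z] survives the
    deletion, and [u] hangs from [z]. *)
Lemma del_edge_paw (u v w z : G) : w != u -> ~~ adj u w ->
  adj u v -> adj v w -> adj u z -> adj v z -> adj z w ->
  paw_pattern (flip_adj u v) v w z u.
Proof.
move=> wu uw uv vw uz vz zw.
have wv : w != v by rewrite eq_sym adj_neq.
have zu : z != u by rewrite eq_sym adj_neq.
have zv : z != v by rewrite eq_sym adj_neq.
rewrite /paw_pattern !(flip_adj_off _ wu wv) !(flip_adj_off _ zu zv).
by rewrite !(flip_adj_diag (adj_neq uv)) uv uw vw uz vz zw.
Qed.

Lemma separated_flip_paw (u v : G) (C : {set G}) :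
  multipartite_saturated C -> u \in C -> v \in C -> u != v ->
  exists a b c d : G, paw_pattern (flip_adj u v) a b c d.
Proof.
move=> CP uC vC uv; have [trans [a [b [_ [[aC bC _] /and3P[ab _ _]]]]] sep] := CP.
have [w wC /and3P[wu wv]] := sep _ _ uC vC uv.
rewrite ![adj w _]adj_sym => wuv.
case: (boolP (adj u v)) => [adj_uv|nadj_uv].
  have [z zC /andP[uz vz]] := triangle_multipartite CP uC vC adj_uv.
  have := trans _ _ _ uC vC wC adj_uv.
  have := trans _ _ _ uC zC wC uz; have := trans _ _ _ vC zC wC vz.
  (* If [w] is adjacent to [u], it misses [v], and [u] and [v] exchange roles. *)
  move: wuv; case: (boolP (adj u w)) => [uw vw|uw _].
    move: vw => /= vw; rewrite (negbTE vw) /= => zw _ _; exists u, w, z, v.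
    have := @del_edge_paw v u w z wv vw; rewrite adj_sym.
    rewrite /paw_pattern !(flip_adjC v u); exact.
  by move=> /= _ zw vw; exists v, w, z, u; apply: del_edge_paw.
(* Now [u], [v] and [w] share a part. For [z] in another part, adding [uv] yields the triangle
   [u v z] with [w] pendant at [z]. *)
have [z zC uz] : exists2 z, z \in C & adj u z.
  have := trans _ _ _ aC bC uC ab.
  by case/orP; rewrite adj_sym; [exists a|exists b].
have vz : adj v z.
  by have := trans _ _ _ uC zC vC uz; rewrite (negbTE nadj_uv) adj_sym.
have uvw : adj u w = adj v w.
  apply/idP/idP=> [uw|vw].
    by have := trans _ _ _ uC wC vC uw; rewrite (negbTE nadj_uv) adj_sym.
  have := trans _ _ _ vC wC uC vw.
  by rewrite ![adj _ u]adj_sym (negbTE nadj_uv).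
have vw : ~~ adj v w by move: wuv; rewrite uvw andbb.
have uw : ~~ adj u w by rewrite uvw.
have zw : adj z w.
  by have := trans _ _ _ uC zC wC uz; rewrite (negbTE uw).
have [zu zv] : z != u /\ z != v by split; rewrite eq_sym adj_neq.
exists u, v, z, w; rewrite /paw_pattern !(flip_adj_off _ wu wv) !(flip_adj_off _ zu zv).
by rewrite !(flip_adj_diag uv) nadj_uv uz vz zw uw vw.
Qed.

(** The edge [uy] lies in a triangle, and the new edge hangs [v] from it at [u]. *)
Lemma disconnected_flip_paw (u v y : G) :
  ~~ connect (@adj G) u v -> adj u y ->
  exists a b c d : G, paw_pattern (flip_adj u v) a b c d.
Proof.
move=> ncuv uy.
have yC : y \in component u by rewrite inE connect1.
have [z zC /andP[uz yz]] :=
  triangle_multipartite (components_saturated uy) (mem_component u) yC uy.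
have off x : x \in component u -> x != v /\ ~~ adj v x.
  rewrite inE => ux; split; first by apply: contraNneq ncuv => <-.
  by apply: contraNN ncuv => vx; rewrite (connect_trans ux) // connect1 // adj_sym.
have [[[uv nuv] [yv vy]] [zv vz]] := (off _ (mem_component u), off _ yC, off _ zC).
have [yu zu] : y != u /\ z != u by rewrite ![_ == u]eq_sym !adj_neq.
exists y, z, u, v; rewrite /paw_pattern !(flip_adj_off _ yu yv) !(flip_adj_off _ zu zv).
by rewrite !(flip_adj_diag uv) [adj u v]adj_sym [adj z y]adj_sym nuv uy uz yz vy vz.
Qed.

End Components.

Theorem theorem2p4 (G : sgraph) :
  induced_saturated paw G <->
  #|[set C : {set G} | trivial_component C]| <= 1 /\
  (forall C : {set G}, nontrivial_component C ->
     exists P : {set {set induced C}},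
       [/\ complete_multipartite P,
           3 <= #|P|,
           #|[set A in P | #|A| == 1]| <= 1
         & forall A, A \in P -> #|A| != 1 -> 3 <= #|A| ]).
Proof.
split=> [satG|[triv nontriv]].
  have [free sat] := satG; split.
    apply/card_le1_eqP=> C D; rewrite !inE.
    case/trivial_componentP=> x -> xx /trivial_componentP[y -> yy].
    case: (eqVneq x y) => [->//|xy].
    (* A vertex separating two isolated vertices would have to be connected to one of them. *)
    have [w xyw /and3P[wx wy _]] := flip_paw_separates free xy (sat _ _ xy).
    have: w \in component x :|: component y by rewrite !inE.
    by rewrite xx yy !inE (negbTE wx) (negbTE wy).
  move=> C /nontrivial_componentP[x [y [-> xy]]].
  by apply/multipartiteP/induced_multipartiteP; exact: saturated_component xy.
have compP (x y : G) : adj x y -> multipartite_saturated (component x).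
  move=> xy; apply/induced_multipartiteP/multipartiteP/nontriv.
  by apply/nontrivial_componentP; exists x, y.
split; first exact: multipartite_paw_free.
move=> u v uv; apply/(flip_pawP uv).
case: (boolP (connect (@adj G) u v)) => [cuv|ncuv].
  have [y uy] : exists y, adj u y.
    case/connectP: cuv uv => -[|y p] /=; first by move=> _ ->; rewrite eqxx.
    by case/andP=> uy; exists y.
  by apply: (separated_flip_paw (compP _ _ uy)); rewrite ?mem_component ?inE.
(* If both were isolated, there would be two trivial components. *)
have [[y uy]|[y vy]] : (exists y, adj u y) \/ (exists y, adj v y).
- case: (pickP (adj u)) => [y ?|u0]; first by left; exists y.
  case: (pickP (adj v)) => [y ?|v0]; first by right; exists y.
  have isolated (x : G) : adj x =1 xpred0 -> trivial_component [set x].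
    move=> x0; apply/trivial_componentP; exists x => //; apply/setP=> y.
    rewrite !inE; apply/connectP/eqP => [[[|z p] /=]|->]; last by exists [::].
      by move=> _ ->.
    by rewrite x0.
  case/eqP: uv; apply: set1_inj.
  by apply: (card_le1_eqP triv); rewrite inE isolated.
- exact: disconnected_flip_paw uy.
have nvu : ~~ connect (@adj G) v u by rewrite connect_adj_sym.
have [a [b [c [d H]]]] := disconnected_flip_paw compP nvu vy.
by exists a, b, c, d; move: H; rewrite /paw_pattern !(flip_adjC v u).
Qed.
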